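(* There exist a measurable set $S\subset\mathbb{R}$ of finite Lebesgue measure and a function $F\in L^2(\mathbb{R})$, not almost everywhere equal to $0$, such that $F$ is supported on $S$ and the spectrum $Q$ of $F$ satisfies $$|Q\cap(-R,R)| = o(R)\quad\text{as } R\to\infty,$$ that is, $\lim_{R\to\infty}\frac{1}{R}\,|Q\cap(-R,R)|=0$. In addition, $F$ can be chosen to be the indicator function of $S$: there exists a measurable set $S\subset\mathbb{R}$ with $0<|S|<\infty$ such that the spectrum $Q$ of $F=\mathbf{1}_S$ satisfies $|Q\cap(-R,R)|=o(R)$ as $R\to\infty$.
   Context: $|A|$ denotes the Lebesgue measure of a set $A\subset\mathbb{R}$. A function $F\in L^2(\mathbb{R})$ is said to be supported on (or by) a set $S\subset\mathbb{R}$ if $F=0$ almost everywhere on $\mathbb{R}\setminus S$. If $S$ has finite Lebesgue measure, then $F\in L^1(\mathbb{R})$, so its Fourier transform $\widehat F$ is a continuous function on $\mathbb{R}$. The spectrum of $F$ is then defined as the closure of the set $\{\xi\in\mathbb{R}:\widehat F(\xi)\neq 0\}$. *)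

(* Defs.v *)
From HB Require Import structures.
From mathcomp Require Import all_boot all_order all_algebra.
From mathcomp Require Import all_classical all_reals all_analysis.
From mathcomp Require Import complex.
Set Implicit Arguments.
Unset Strict Implicit.
Unset Printing Implicit Defensive.
Import Order.TTheory GRing.Theory Num.Theory.
Import numFieldNormedType.Exports.
Local Open Scope classical_set_scope.
Local Open Scope ring_scope.

(* Complex numbers are pairs [a +i* b] over [R]; the measure-theoretic library
   treats real-valued functions only, so measurability and integration of
   complex-valued functions are componentwise. *)

Local Notation leb R := (@lebesgue_measure R).

Definition cmeasurable (R : realType) (F : R -> R[i]) : Prop :=
  measurable_fun setT (fun x => complex.Re (F x)) /\
  measurable_fun setT (fun x => complex.Im (F x)).

Definition cintegral (R : realType) (F : R -> R[i]) : R[i] :=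
  Complex (\int[leb R]_x complex.Re (F x)) (\int[leb R]_x complex.Im (F x)).

Definition L2 (R : realType) (F : R -> R[i]) : Prop :=
  cmeasurable F /\
  finite_norm (leb R) 2%:E (fun x => ComplexField.Normc.normc (F x)).

Definition supported_on (R : realType) (F : R -> R[i]) (S : set R) : Prop :=
  {ae leb R, forall x, ~ S x -> F x = 0}.

Definition cexpi (R : realType) (t : R) : R[i] := Complex (cos t) (sin t).

(* [\hat F(xi) = \int F(x) e^{-2 i pi x xi} dx], an absolutely convergent
   integral for [F] integrable.  It is only meaningful for such [F], as
   [\int] returns a default value when the integral is not finite. *)
Definition fourier (R : realType) (F : R -> R[i]) (xi : R) : R[i] :=
  cintegral (fun x => F x * cexpi (- (2 * pi * x * xi))).

Definition spectrum (R : realType) (F : R -> R[i]) : set R :=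
  closure [set xi | fourier F xi != 0].

(* [|Q \cap (-r, r)| = o(r)] as [r] tends to infinity. *)
Definition sublinear_measure (R : realType) (Q : set R) : Prop :=
  ((r^-1)%:E * leb R (Q `&` `](- r)%R, r[))%E @[r --> +oo%R] --> 0%E.

Definition cindic (R : realType) (S : set R) (x : R) : R[i] :=
  Complex (\1_S x) 0.

(* Main.v *)
Require Import Defs.
From HB Require Import structures.
From mathcomp Require Import all_boot all_order all_algebra.
From mathcomp Require Import all_classical all_reals all_analysis.
From mathcomp Require Import measurable_realfun complex ring lra.
Set Implicit Arguments.
Unset Strict Implicit.
Unset Printing Implicit Defensive.
Import Order.TTheory GRing.Theory Num.Theory.
Import numFieldNormedType.Exports.
Local Open Scope classical_set_scope.
Local Open Scope ring_scope.

(* Start from the Fejer kernel [f_0 = (sin (pi x) / (pi x))^2], which takes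
   values in [0, 1], is integrable and has spectrum [-1, 1], and put
   [f_{n+1} = f_n + g_n cos (2 pi N_n x)] with [g_n = f_n (1 - f_n)].  The values
   stay in [0, 1], and the spectrum gained at step [n] lies within [2 b_n] of
   [N_n] and of [- N_n], where [b_n] bounds the band of [f_n].  For [N_n] large
   compared with [b_n] the oscillating cross terms integrate to [0], so the
   integral of [f_n] is constant while that of [f_n ^ 2] grows by half that of
   [g_n ^ 2]; as [f_n ^ 2 <= f_n], the sum of the squares [g_n ^ 2] is integrable
   and [g_n] tends to [0] almost everywhere.  Since [g_n] also bounds
   [|f_{n+1} - f_n|], the sequence cannot keep jumping between a neighbourhood
   of [0] and one of [1], hence converges almost everywhere to an indicator.

   Band limitation is expressed without Fourier inversion: [k] has band [s] when
   [k] times any cosine of frequency beyond [s] integrates to [0], and the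
   functions multiplying band [t] into band [s + t] are closed under products and
   bounded pointwise limits.  The function [sin x / x] is such a multiplier by
   Viete's product of cosines. *)

(** * Dominated convergence and linear changes of variable *)

Section RealIntegrals.
Context {R : realType}.
Local Notation mu := (@lebesgue_measure R).
Local Notation intble k := (mu.-integrable setT (EFin \o k)).
Implicit Types (h k : R -> R) (a s t x xi theta : R).

Lemma integrableM_bounded h k (C : R) : measurable_fun setT h ->
  (forall x, `|h x| <= C) -> intble k -> intble (fun x => h x * k x).
Proof.
move=> mh hC ik; have mk : measurable_fun setT k.
  by apply/measurable_EFinP; exact: measurable_int ik.
apply: (@le_integrable _ _ _ mu setT measurableT _ (EFin \o (fun x => C * k x))).
- by apply/measurable_EFinP; exact: measurable_funM.
- move=> x _ /=; rewrite lee_fin !normrM.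
  by rewrite ler_wpM2r// (le_trans (hC x))// ler_norm.
- exact: (integrableZl measurableT C ik).
Qed.

Lemma ae_mono (P Q : R -> Prop) : (forall x, P x -> Q x) ->
  {ae mu, forall x, P x} -> {ae mu, forall x, Q x}.
Proof. exact: (@filterS _ _ (ae_filter_ringOfSetsType lebesgue_measure)). Qed.

Lemma Rintegral_cvg (f : (R -> R)^nat) (g b : R -> R) :
  (forall n, measurable_fun setT (f n)) -> measurable_fun setT g ->
  {ae mu, forall x, f ^~ x @ \oo --> g x} -> intble b ->
  (forall n x, `|f n x| <= b x) ->
  intble g /\ (fun n => \int[mu]_x f n x) @ \oo --> \int[mu]_x g x.
Proof.
move=> mf mg fg ib fb.
have [] := @dominated_convergence _ _ _ mu setT measurableT
  (fun n => EFin \o f n) (EFin \o g) (EFin \o b).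
- by move=> n; apply/measurable_EFinP; exact: mf.
- by apply/measurable_EFinP; exact: mg.
- apply: ae_mono fg => x fgx _; apply: cvg_EFin; first exact: nearW.
  exact: fgx.
- exact: ib.
- by apply/aeW => x n _ /=; rewrite lee_fin.
move=> ig _ cv; split; first exact: ig.
apply: fine_cvg; rewrite fineK; first exact: cv.
exact: integrable_fin_num.
Qed.

(** The pushforward of Lebesgue measure under [x -> a x], multiplied by [a], gives every interval
    its length, so uniqueness of Lebesgue measure identifies the two. *)
Lemma lebesgue_measure_scale a (A : set R) : 0 < a -> measurable A ->
  (a%:E * mu ((fun x : R => a * x)%R @^-1` A) = mu A)%E.
Proof.
move=> a0 mA.
pose scale : measurableTypeR R -> measurableTypeR R := fun x => a * x.
have m_scale : measurable_fun setT scale.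
  exact: (@measurable_funM _ _ R setT (cst a) id).
pose nu : {measure set (measurableTypeR R) -> \bar R} :=
  mscale (NngNum (ltW a0)) (pushforward mu scale).
rewrite -[LHS]/(nu m_scale A); apply/esym/lebesgue_measure_unique => //= _ [[u v]] _ <-.
rewrite /mscale/= /pushforward.
rewrite (_ : _ @^-1` _ = `]u / a, v / a]%classic); last first.
  by apply/seteqP; split=> x /=; rewrite !in_itv/= ltr_pdivrMr// ler_pdivlMr//
    ![_ * a]mulrC.
rewrite !lebesgue_measure_itv/= !lte_fin ltr_pM2r ?invr_gt0//.
case: ifPn => uv; last by rewrite mule0.
rewrite -!EFinD; congr EFin; field; by rewrite gt_eqF.
Qed.

Lemma integral_scale a (f : R -> \bar R) : 0 < a ->
  measurable_fun setT f -> (forall x, 0 <= f x)%E ->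
  (a%:E * \int[mu]_x f (a * x)%R = \int[mu]_x f x)%E.
Proof.
move=> a0 mf f0.
pose scale : measurableTypeR R -> measurableTypeR R := fun x => a * x.
have m_scale : measurable_fun setT scale.
  exact: (@measurable_funM _ _ R setT (cst a) id).
pose nu : {measure set (measurableTypeR R) -> \bar R} :=
  mscale (NngNum (ltW a0)) (pushforward mu scale).
transitivity (\int[nu m_scale]_x f x)%E; last first.
  apply: eq_measure_integral => A mA _; exact: lebesgue_measure_scale.
rewrite ge0_integral_mscale//= ge0_integral_pushforward//.
Qed.

Lemma integral_reflect (f : R -> \bar R) :
  measurable_fun setT f -> (forall x, 0 <= f x)%E ->
  (\int[mu]_x f (- x)%R = \int[mu]_x f x)%E.
Proof.
move=> mf f0.
transitivity (\int[pushforward mu (-%R : _ -> measurableTypeR R)]_x f x)%E.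
  by rewrite ge0_integral_pushforward.
by apply: eq_measure_integral => A mA _; exact: lebesgue_measureN.
Qed.

Lemma Rintegral_reflect k : measurable_fun setT k ->
  \int[mu]_x k (- x) = \int[mu]_x k x.
Proof.
move=> mk; have mEk : measurable_fun setT (EFin \o k) by exact/measurable_EFinP.
rewrite /Rintegral; congr fine; rewrite integralE [RHS]integralE.
have mp := measurable_funepos mEk; have mn := measurable_funeneg mEk.
congr (_ - _)%E.
  rewrite -[RHS](integral_reflect mp (funepos_ge0 _)).
  by apply: eq_integral => x _; rewrite !funeposE.
rewrite -[RHS](integral_reflect mn (funeneg_ge0 _)).
by apply: eq_integral => x _; rewrite !funenegE.
Qed.

End RealIntegrals.

(** * The function sin x / x and Viete's product *)

Section Sinc.
Context {R : realType}.
Local Notation mu := (@lebesgue_measure R).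
Local Notation intble k := (mu.-integrable setT (EFin \o k)).
Implicit Types (a u v x : R).

Definition sinc x : R := if x == 0 then 1 else sin x / x.

Lemma sinc0 : sinc 0 = 1. Proof. by rewrite /sinc eqxx. Qed.

Lemma sin_sinc x : sin x = x * sinc x.
Proof.
rewrite /sinc; case: eqVneq => [->|x0]; first by rewrite sin0 mul0r.
by rewrite mulrC divfK.
Qed.

Lemma sincN x : sinc (- x) = sinc x.
Proof. by rewrite /sinc oppr_eq0; case: eqP => // _; rewrite sinN invrN mulrNN. Qed.

Lemma sinc_half x : sinc x = cos (x / 2) * sinc (x / 2).
Proof.
have [->|x0] := eqVneq x 0; first by rewrite mul0r cos0 mul1r.
have : sin (x / 2 *+ 2) = sin x by congr sin; rewrite mulr2n; lra.
rewrite sin_mulr2n sin_sinc [in RHS]sin_sinc => e.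
apply: (mulfI x0); rewrite -e mulr2n; lra.
Qed.

(** Off the origin [sinc] is the difference quotient of [sin] at [0], so the limit is the derivative
    [cos 0]. *)
Lemma sinc_cvg0 : sinc y @[y --> 0] --> (1 : R).
Proof.
rewrite -[X in _ --> X]sinc0; apply/continuous_withinNx.
have d0 : is_derive (0 : R) 1 sin (cos 0) by exact: is_derive_sin.
have : derivable (sin : R -> R) 0 1 by exact: ex_derive.
rewrite /derivable => /cvg_ex[l cl].
have l1 : l = 1.
  have := @derive_val _ _ _ _ _ _ _ d0; rewrite /derive cos0 => <-.
  by apply/esym/cvg_lim.
rewrite sinc0 -l1; apply/cvgrPdist_lt => e e0.
move/cvgrPdist_lt : cl => /(_ e e0) cl.
near=> y; have y0 : y != 0 by near: y; exact: nbhs_dnbhs_neq.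
have -> : sinc y = y^-1 *: ((sin \o shift 0) (y%:A) - sin 0).
  by rewrite /sinc (negbTE y0) /= addr0 sin0 subr0 /GRing.scale/= mulr1 mulrC.
by near: y.
Unshelve. all: by end_near. Qed.

Fixpoint viete (n : nat) x : R :=
  if n is n.+1 then viete n x * cos (x / 2 ^+ n.+1) else 1.

(** Iterating the half-angle formula leaves a remainder [sinc (x / 2 ^+ n)] that tends to [1],
    whence the infinite product. *)
Lemma sinc_viete n x : sinc x = viete n x * sinc (x / 2 ^+ n).
Proof.
elim: n => [|n IH]; first by rewrite expr0 divr1 mul1r.
by rewrite IH /= [in LHS]sinc_half mulrA exprSr invfM mulrA.
Qed.

Lemma viete_le1 n x : `|viete n x| <= 1.
Proof.
elim: n => /= [|n IH]; first by rewrite normr1.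
by rewrite normrM mulr_ile1// cos_max.
Qed.

Lemma viete_cvg x : viete ^~ x @ \oo --> sinc x.
Proof.
have cs : sinc (x / 2 ^+ n) @[n --> \oo] --> (1 : R).
  apply: (cvg_comp _ _ _ sinc_cvg0).
  have : `|2^-1 : R| < 1 by rewrite ger0_norm; lra.
  move/(cvg_geometric x); rewrite /geometric/=.
  by under eq_fun do rewrite exprVn.
apply/cvgrPdist_le => e e0; move/cvgrPdist_le : cs => /(_ e e0).
apply: filterS => n; apply: le_trans.
rewrite (sinc_viete n) -[X in _ - X]mulr1 -mulrBr normrM distrC.
by rewrite ler_piMl// viete_le1.
Qed.

Lemma sinc_le1 x : `|sinc x| <= 1.
Proof.
have /cvg_norm cv := @viete_cvg x.
rewrite -(cvg_lim _ cv)//; apply: limr_le; first exact: (cvgP _ cv).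
by apply: nearW => n; exact: viete_le1.
Qed.

Lemma measurable_viete n : measurable_fun setT (viete n).
Proof.
elim: n => [|n IH] /=; first exact: measurable_cst.
apply: measurable_funM => //; apply: measurableT_comp.
  by apply: continuous_measurable_fun; exact: continuous_cos.
exact: measurable_funM.
Qed.

Lemma measurable_sinc : measurable_fun setT sinc.
Proof.
by apply: (measurable_fun_cvg measurable_viete) => x _; exact: viete_cvg.
Qed.

(** Add the bounds [sinc x ^+ 2 <= 1] and [(x * sinc x) ^+ 2 = sin x ^+ 2 <= 1]. This gives an
    integrable majorant. *)
Lemma sinc_sqr_le x : sinc x ^+ 2 <= 2 * (1 + x ^+ 2)^-1.
Proof.
have h : 0 < 1 + x ^+ 2 by rewrite ltr_wpDr// sqr_ge0.
rewrite ler_pdivlMr//.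
have e : (x * sinc x) ^+ 2 <= 1.
  by rewrite -sin_sinc sin2cos2 lerBlDr lerDl sqr_ge0.
have : sinc x ^+ 2 <= 1 by have := sinc_le1 x; rewrite ler_norml => /andP[]; nra.
nra.
Qed.

Lemma integrable_oneDsqrV : intble (fun x => (1 + x ^+ 2)^-1).
Proof.
have m1 : measurable_fun setT (fun x : R => (1 + x ^+ 2)^-1).
  by apply: continuous_measurable_fun; exact: continuous_oneDsqrV.
apply/integrableP; split; first exact/measurable_EFinP.
under eq_integral => x _.
  rewrite /= ger0_norm; last by rewrite invr_ge0 addr_ge0// sqr_ge0.
  over.
have mE : measurable_fun setT (fun x : R => ((1 + x ^+ 2)^-1)%:E).
  exact/measurable_EFinP.
have ge0 x : (0 <= ((1 + x ^+ 2)^-1)%:E :> \bar R)%E.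
  by rewrite lee_fin invr_ge0 addr_ge0// sqr_ge0.
rewrite ge0_symfun_integralT//.
- rewrite (_ : [set x | _] = `[0, +oo[%classic); last first.
    by apply/seteqP; split => x/=; rewrite in_itv/= andbT.
  by rewrite integral0y_oneDsqr -EFinM ltry.
- exact: continuous_oneDsqrV.
- by move=> x; rewrite /= sqrrN.
Qed.

End Sinc.

(** * Band-limited functions and their multipliers *)

Section BandLimited.
Context {R : realType}.
Local Notation mu := (@lebesgue_measure R).
Local Notation intble k := (mu.-integrable setT (EFin \o k)).
Implicit Types (h k : R -> R) (a s t u v x xi theta : R).

(** The free phase [theta] treats cosines and sines at once, so the condition says that the Fourier
    transform of [k] vanishes outside [-s, s]. *)
Definition band s k := intble k /\ forall xi theta, s < `|xi| ->
  \int[mu]_x (k x * cos (2 * pi * xi * x + theta)) = 0.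

(** This stands in for having a distributional spectrum in [-s, s]: it makes sense for bounded
    functions that are not integrable, such as cosines and constants. *)
Definition multiplier s h :=
  [/\ measurable_fun setT h, exists C, forall x, `|h x| <= C &
      forall t k, band t k -> band (s + t) (fun x => h x * k x)].

Lemma measurable_cos_affine a theta :
  measurable_fun setT (fun x : R => cos (a * x + theta)).
Proof.
apply: measurableT_comp.
  by apply: continuous_measurable_fun; exact: continuous_cos.
by apply: measurable_funD => //; exact: measurable_funM.
Qed.

Lemma integrable_cos_affine a theta k : intble k ->
  intble (fun x => k x * cos (a * x + theta)).
Proof.
move=> ik; under eq_fun do rewrite mulrC.
apply: (integrableM_bounded (measurable_cos_affine a theta)) ik => x.
exact: cos_max.
Qed.

Lemma band_le s t k : s <= t -> band s k -> band t k.
Proof.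
by move=> st [ik bk]; split=> // xi theta tx; apply: bk; exact: le_lt_trans tx.
Qed.

Lemma bandD s k1 k2 : band s k1 -> band s k2 -> band s (fun x => k1 x + k2 x).
Proof.
move=> [i1 b1] [i2 b2]; split; first exact: integrableD i1 i2.
move=> xi theta sx; under eq_Rintegral do rewrite mulrDl.
rewrite RintegralD//; try exact: integrable_cos_affine.
by rewrite b1// b2// addr0.
Qed.

Lemma bandZ s c k : band s k -> band s (fun x => c * k x).
Proof.
move=> [ik bk]; split; first exact: (integrableZl measurableT c ik).
move=> xi theta sx; under eq_Rintegral do rewrite -mulrA.
by rewrite RintegralZl//; [rewrite bk// mulr0|exact: integrable_cos_affine].
Qed.

Lemma multiplier_le s t h : s <= t -> multiplier s h -> multiplier t h.
Proof.
move=> st [mh bh Mh]; split=> // r k /Mh; apply: band_le; exact: lerD.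
Qed.

Lemma multiplier_cst s c : 0 <= s -> multiplier s (cst c).
Proof.
move=> s0; split; [exact: measurable_cst|by exists `|c| |].
by move=> t k bk; apply: (@band_le t); [rewrite lerDr|exact: bandZ].
Qed.

Lemma multiplierD s h1 h2 : multiplier s h1 -> multiplier s h2 ->
  multiplier s (fun x => h1 x + h2 x).
Proof.
move=> [m1 [C1 b1] M1] [m2 [C2 b2] M2]; split; first exact: measurable_funD.
  exists (C1 + C2) => x; exact: le_trans (ler_normD _ _) (lerD (b1 x) (b2 x)).
move=> t k bk; under eq_fun do rewrite mulrDl.
by apply: bandD; [exact: M1|exact: M2].
Qed.

Lemma multiplierM s t h1 h2 : multiplier s h1 -> multiplier t h2 ->
  multiplier (s + t) (fun x => h1 x * h2 x).
Proof.
move=> [m1 [C1 b1] M1] [m2 [C2 b2] M2]; split; first exact: measurable_funM.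
  by exists (C1 * C2) => x; rewrite normrM ler_pM.
move=> r k bk; under eq_fun do rewrite -mulrA.
by rewrite -addrA; apply: M1; exact: M2.
Qed.

(** The product-to-sum formula turns the integral into the mean of those of [k] at the frequencies
    [xi + nu] and [xi - nu], both out of band. *)
Lemma band_modulate s k nu xi theta : band s k ->
  s < `|xi - nu| -> s < `|xi + nu| ->
  \int[mu]_x (cos (2 * pi * nu * x) * k x * cos (2 * pi * xi * x + theta)) = 0.
Proof.
move=> [ik bk] sB sD.
under eq_Rintegral => x _.
  rewrite (_ : _ * _ * _ = 2^-1 * (k x * cos (2 * pi * (xi + nu) * x + theta)) +
    2^-1 * (k x * cos (2 * pi * (xi - nu) * x + theta))); last first.
    rewrite (_ : 2 * pi * (xi + nu) * x + theta =
      (2 * pi * xi * x + theta) + 2 * pi * nu * x); last by ring.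
    rewrite (_ : 2 * pi * (xi - nu) * x + theta =
      (2 * pi * xi * x + theta) - 2 * pi * nu * x); last by ring.
    move: (2 * pi * xi * x + theta) (2 * pi * nu * x) => A B.
    by rewrite cosD cosB; field.
  over.
have ic a : intble (fun x => k x * cos (a * x + theta)).
  exact: integrable_cos_affine.
rewrite RintegralD//; try exact: (integrableZl measurableT 2^-1 (ic _)).
rewrite !RintegralZl//; try exact: ic.
by rewrite !bk// mulr0 addr0.
Qed.

Lemma multiplier_cos s : 0 <= s -> multiplier s (fun x => cos (2 * pi * s * x)).
Proof.
move=> s0; have mc : measurable_fun setT (fun x => cos (2 * pi * s * x)).
  by under eq_fun do rewrite -[2 * pi * s * _]addr0; exact: measurable_cos_affine.
split=> //; first by exists 1 => x; exact: cos_max.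
move=> t k bk; have [ik _] := bk; split.
  by apply: (integrableM_bounded mc) ik => x; exact: cos_max.
move=> xi theta sx; apply: band_modulate bk _ _.
  by have := ler_normD (xi - s) s; rewrite subrK (ger0_norm s0); lra.
by have := ler_normB (xi + s) s; rewrite addrK (ger0_norm s0); lra.
Qed.

(** A band condition says that certain integrals are zero, which survives dominated convergence with
    majorant [C * |k|]. *)
Lemma multiplier_lim s C (h_ : (R -> R)^nat) h :
  (forall n, multiplier s (h_ n)) -> (forall n x, `|h_ n x| <= C) ->
  (forall x, h_ ^~ x @ \oo --> h x) -> multiplier s h.
Proof.
move=> Mh bh cvh.
have mh_ n : measurable_fun setT (h_ n) by have [] := Mh n.
have mh : measurable_fun setT h by apply: (measurable_fun_cvg mh_) => x _.
have hC x : `|h x| <= C.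
  have /cvg_norm cv := cvh x.
  rewrite -(cvg_lim _ cv)//; apply: limr_le; first exact: (cvgP _ cv).
  by apply: nearW => n; exact: bh.
split=> //; first by exists C.
move=> t k bk; have [ik _] := bk.
split; first exact: (integrableM_bounded mh hC).
move=> xi theta sx.
have mk : measurable_fun setT k by apply/measurable_EFinP; exact: measurable_int ik.
have [] := @Rintegral_cvg R (fun n x => h_ n x * k x * cos (2 * pi * xi * x + theta))
   (fun x => h x * k x * cos (2 * pi * xi * x + theta)) (fun x => C * `|k x|).
- move=> n; apply: measurable_funM; first exact: measurable_funM.
  exact: measurable_cos_affine.
- apply: measurable_funM; first exact: measurable_funM.
  exact: measurable_cos_affine.
- apply: aeW => x; apply: cvgM; last exact: cvg_cst.
  by apply: cvgM; [exact: cvh|exact: cvg_cst].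
- exact: (integrableZl measurableT C (integrable_norm ik)).
- move=> n x; rewrite !normrM -[leRHS]mulr1 ler_pM ?cos_max//.
  by rewrite ler_wpM2r.
move=> _; under eq_fun => n.
  have [_ _ /(_ t k bk) [_ ->//]] := Mh n; over.
by move=> cv; rewrite -(cvg_lim _ cv)// lim_cst.
Qed.

End BandLimited.

(** * The Fejer kernel of width [e] and its band *)

Section FejerKernel.
Context {R : realType}.
Local Notation mu := (@lebesgue_measure R).
Local Notation intble k := (mu.-integrable setT (EFin \o k)).
Implicit Types (e a u v x xi theta : R).

Definition fejer e x := sinc (pi * e * x) ^+ 2.

Lemma multiplier_sinc e : 0 <= e -> multiplier (e / 2) (fun x => sinc (pi * e * x)).
Proof.
move=> e0; apply: (@multiplier_lim _ _ 1 (fun n x => viete n (pi * e * x))).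
(* The first [n] cosine factors have frequencies [e / 2 * 2^-1 ^+ j] for [1 <= j <= n], and this is
   their sum. *)
- move=> n; apply: (@multiplier_le _ (e / 2 * (1 - 2^-1 ^+ n))).
    by rewrite ler_piMr ?divr_ge0// lerBlDr lerDl exprn_ge0.
  elim: n => [|n IH] /=.
    by rewrite expr0 subrr mulr0; exact: multiplier_cst.
  rewrite (_ : e / 2 * _ = e / 2 * (1 - 2^-1 ^+ n) + e / 2 * 2^-1 ^+ n.+1); last first.
    by rewrite exprS; field.
  apply: multiplierM => //.
  rewrite (_ : (fun x => _) = (fun x => cos (2 * pi * (e / 2 * 2^-1 ^+ n.+1) * x))).
    by apply: multiplier_cos; rewrite mulr_ge0 ?divr_ge0// exprn_ge0.
  by apply/funext => x; congr cos; rewrite exprVn; field; rewrite expf_neq0.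
- by move=> n x; exact: viete_le1.
- by move=> x; exact: viete_cvg.
Qed.

Lemma multiplier_fejer e : 0 <= e -> multiplier e (fejer e).
Proof.
move=> e0; rewrite [X in multiplier X](_ : _ = e / 2 + e / 2); last by field.
by rewrite /fejer; under eq_fun do rewrite expr2; apply: multiplierM; exact: multiplier_sinc.
Qed.

Lemma fejer_ge0 e x : 0 <= fejer e x. Proof. exact: sqr_ge0. Qed.

Lemma fejer_le1 e x : fejer e x <= 1.
Proof.
by have := sinc_le1 (pi * e * x); rewrite /fejer ler_norml => /andP[]; nra.
Qed.

Lemma measurable_sinc_sqr a : measurable_fun setT (fun x : R => sinc (a * x) ^+ 2).
Proof.
apply: measurable_funX; apply: measurableT_comp; first exact: measurable_sinc.
exact: measurable_funM.
Qed.

Lemma integrable_sinc_sqr : intble (fun x => sinc x ^+ 2).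
Proof.
have i2 := integrableZl measurableT 2 (@integrable_oneDsqrV R).
apply: (le_integrable measurableT _ _ i2).
  by apply/measurable_EFinP/measurable_funX; exact: measurable_sinc.
move=> x _ /=; rewrite lee_fin !ger0_norm ?sqr_ge0//; first exact: sinc_sqr_le.
by rewrite mulr_ge0// invr_ge0 addr_ge0// sqr_ge0.
Qed.

Lemma integral_sinc_sqr_scale a : a != 0 ->
  (\int[mu]_x (sinc (a * x) ^+ 2)%:E =
   (`|a|^-1 * \int[mu]_x (sinc x ^+ 2))%:E)%E.
Proof.
move=> a0; have p : 0 < `|a| by rewrite normr_gt0.
have -> : (fun x => (sinc (a * x) ^+ 2)%:E) = (fun x => (sinc (`|a| * x) ^+ 2)%:E).
  apply/funext => x; congr EFin; case: (ler0P a) => //.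
  by rewrite mulNr sincN.
have ms : measurable_fun setT (fun x : R => (sinc x ^+ 2)%:E).
  by apply/measurable_EFinP/measurable_funX; exact: measurable_sinc.
have sc := integral_scale p ms (fun x => sqr_ge0 _).
have ifin := integrable_fin_num measurableT integrable_sinc_sqr.
rewrite [RHS]EFinM /Rintegral fineK// -sc.
by rewrite muleA -EFinM mulVf ?gt_eqF// mul1e.
Qed.

Lemma integrable_sinc_sqr_scale a : a != 0 -> intble (fun x => sinc (a * x) ^+ 2).
Proof.
move=> a0; apply/integrableP; split.
  by apply/measurable_EFinP; exact: measurable_sinc_sqr.
under eq_integral do rewrite /= ger0_norm ?sqr_ge0//.
by rewrite integral_sinc_sqr_scale// ltry.
Qed.

(** The factor [a ^+ 2] covers [a = 0], where the squared [sinc] is the constant [1]. *)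
Lemma integrable_sqr_sinc_sqr a : intble (fun x => a ^+ 2 * sinc (a * x) ^+ 2).
Proof.
have [->|a0] := eqVneq a 0.
  under eq_fun do rewrite expr0n mul0r.
  exact: integrable0.
exact: (integrableZl measurableT (a ^+ 2) (integrable_sinc_sqr_scale a0)).
Qed.

Lemma Rintegral_sqr_sinc_sqr a :
  \int[mu]_x (a ^+ 2 * sinc (a * x) ^+ 2) = `|a| * \int[mu]_x (sinc x ^+ 2).
Proof.
have [->|a0] := eqVneq a 0.
  under eq_Rintegral do rewrite expr0n mul0r.
  by rewrite normr0 mul0r Rintegral_cst// mul0r.
rewrite RintegralZl//; last exact: integrable_sinc_sqr_scale.
rewrite {1}/Rintegral integral_sinc_sqr_scale//=.
by rewrite -real_normK ?num_real// expr2 mulrA mulfK// normr_eq0.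
Qed.

(** Multiplied by [x ^+ 2] with A = ux and B = vx, this is the identity sin^2 A cos 2B = (sin^2 (A +
    B) + sin^2 (A - B)) / 2 - sin^2 B. Each term on the right has an integral known by scaling. *)
Lemma sinc_sqr_cos u v x : u ^+ 2 * (sinc (u * x) ^+ 2 * cos (2 * (v * x))) =
  2^-1 * ((u + v) ^+ 2 * sinc ((u + v) * x) ^+ 2) +
  2^-1 * ((u - v) ^+ 2 * sinc ((u - v) * x) ^+ 2) - v ^+ 2 * sinc (v * x) ^+ 2.
Proof.
have [->|x0] := eqVneq x 0.
  by rewrite !mulr0 sinc0 cos0; field.
have sE a : a ^+ 2 * sinc (a * x) ^+ 2 = sin (a * x) ^+ 2 / x ^+ 2.
  by rewrite sin_sinc; field.
have c2 : cos (2 * (v * x)) = cos (v * x) ^+ 2 - sin (v * x) ^+ 2.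
  by rewrite mulr_natl cos_mulr2n sin2cos2 mulr2n; ring.
rewrite mulrA !sE c2 [(u + v) * x]mulrDl [(u - v) * x]mulrBl sinD sinB.
have := cos2sin2 (u * x).
move: (sin (u * x)) (cos (u * x)) (sin (v * x)) (cos (v * x)) => su cu sv cv e.
transitivity ((su ^+ 2 * cv ^+ 2 + cu ^+ 2 * sv ^+ 2 - sv ^+ 2) / x ^+ 2).
  by rewrite e; field.
by field.
Qed.

(** Up to the factor [u ^+ 2], the integral is the integral of [sinc ^+ 2], whose value is never
    computed, times (|u + v| + |u - v|) / 2 - |v|. This triangle function of [v] vanishes once |v|
    exceeds [u]. *)
Lemma Rintegral_sinc_sqr_cos u v : 0 < u -> u < `|v| ->
  \int[mu]_x (sinc (u * x) ^+ 2 * cos (2 * (v * x))) = 0.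
Proof.
move=> u0 uv; have u20 : u ^+ 2 != 0 by rewrite expf_neq0// gt_eqF.
apply: (mulfI u20); rewrite mulr0 -RintegralZl//; last first.
  under eq_fun do rewrite mulrA -[2 * v * _]addr0.
  by apply: integrable_cos_affine; apply: integrable_sinc_sqr_scale; rewrite gt_eqF.
under eq_Rintegral do rewrite sinc_sqr_cos.
have i1 a := integrable_sqr_sinc_sqr a.
have i2 a := integrableZl measurableT 2^-1 (i1 a).
rewrite RintegralB//; last exact: integrableD (i2 _) (i2 _).
rewrite RintegralD//; try exact: i2.
have half a : \int[mu]_x (2^-1 * (a ^+ 2 * sinc (a * x) ^+ 2)) =
    2^-1 * (`|a| * \int[mu]_x (sinc x ^+ 2)).
  by rewrite RintegralZl// Rintegral_sqr_sinc_sqr.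
rewrite !half Rintegral_sqr_sinc_sqr !mulrA -mulrDl -mulrBl.
rewrite (_ : _ - _ = 0) ?mul0r//.
by move: uv; case: (ler0P v); case: (ler0P (u + v)); case: (ler0P (u - v)); lra.
Qed.

Lemma band_fejer e : 0 < e -> band e (fejer e).
Proof.
move=> e0; have pe : 0 < pi * e by rewrite mulr_gt0// pi_gt0.
have ik : intble (fejer e) by apply: integrable_sinc_sqr_scale; rewrite gt_eqF.
split=> // xi theta exi.
have cE x : fejer e x * cos (2 * pi * xi * x + theta) =
  cos theta * (fejer e x * cos (2 * (pi * xi * x))) -
  sin theta * (fejer e x * sin (2 * (pi * xi * x))).
  rewrite (_ : 2 * pi * xi * x = 2 * (pi * xi * x)); last by ring.
  by rewrite cosD; ring.
under eq_Rintegral do rewrite cE.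
have ic : intble (fun x => fejer e x * cos (2 * (pi * xi * x))).
  under eq_fun do rewrite mulrA -[2 * _ * _]addr0.
  exact: integrable_cos_affine.
have isn : intble (fun x => fejer e x * sin (2 * (pi * xi * x))).
  under eq_fun do rewrite mulrA -cosBpihalf.
  exact: integrable_cos_affine.
rewrite RintegralB//; [|exact: (integrableZl measurableT _ ic)
  |exact: (integrableZl measurableT _ isn)].
rewrite !RintegralZl// (@Rintegral_sinc_sqr_cos (pi * e) (pi * xi))//; last first.
  by rewrite normrM (ger0_norm (pi_ge0 R)) ltr_pM2l// pi_gt0.
rewrite mulr0 sub0r.
have ms : measurable_fun setT (fun x => fejer e x * sin (2 * (pi * xi * x))).
  by apply/measurable_EFinP; exact: measurable_int isn.
(* The sine part is odd, so reflection shows that its integral equals its own opposite. *)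
have := Rintegral_reflect ms.
under eq_Rintegral do rewrite /fejer mulrN sincN !mulrN sinN mulrN -mulN1r.
rewrite RintegralZl// => h; have : \int[mu]_x (fejer e x * sin (2 * (pi * xi * x))) = 0.
  by move: h; rewrite /fejer; lra.
by move=> ->; rewrite mulr0 oppr0.
Qed.

End FejerKernel.

(** * Sequences in [0, 1] forced towards an end point *)

Section Dichotomy.
Context {R : realType}.

Lemma cvg_dichotomy (u : R^nat) :
  (forall n, 0 <= u n <= 1) ->
  (forall n, `|u n.+1 - u n| <= u n * (1 - u n)) ->
  u n * (1 - u n) @[n --> \oo] --> 0 ->
  ((exists m, forall n, (m <= n)%N -> 2^-1 <= u n) /\ u @ \oo --> (1 : R)) \/
  (~ (exists m, forall n, (m <= n)%N -> 2^-1 <= u n) /\ u @ \oo --> (0 : R)).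
Proof.
move=> u01 du cv.
(* Below 1/8, the product keeps [u n] at distance more than 1/8 from 1/2, while the next step is
   shorter than 1/8: the value 1/2 is never crossed again. *)
have [N _ uN] : \forall n \near \oo, u n * (1 - u n) < 8^-1.
  move/cvgrPdist_lt : cv => /(_ (8^-1) ltac:(lra)); apply: filterS => n.
  by rewrite sub0r normrN => /(le_lt_trans (ler_norm _)).
have [h|h] := lerP (2^-1) (u N).
  left; have hN n : (N <= n)%N -> 2^-1 <= u n.
    elim: n => [|n IH]; first by rewrite leqn0 => /eqP N0; rewrite N0 in h.
    rewrite leq_eqVlt => /predU1P[<-//|]; rewrite ltnS => Nn.
    have := IH Nn; have := uN n Nn; have := du n; have := u01 n.
    by rewrite ler_norml => /andP[? ?] /andP[? ?] ? ?; nra.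
  split; first by exists N.
  (* On the upper half, [1 - u n] is at most twice [u n * (1 - u n)], which explains [e / 2]. *)
  apply/cvgrPdist_lt => e e0; move/cvgrPdist_lt : cv => /(_ (e / 2) ltac:(lra)).
  move=> [M _ uM]; exists (maxn M N) => // n /=.
  rewrite geq_max => /andP[/uM /= + /hN]; rewrite sub0r normrN.
  move=> /(le_lt_trans (ler_norm _)); have /andP[? ?] := u01 n.
  by rewrite ger0_norm; nra.
right; have hN n : (N <= n)%N -> u n < 2^-1.
  elim: n => [|n IH]; first by rewrite leqn0 => /eqP N0; rewrite N0 in h.
  rewrite leq_eqVlt => /predU1P[<-//|]; rewrite ltnS => Nn.
  have := IH Nn; have := uN n Nn; have := du n; have := u01 n.
  by rewrite ler_norml => /andP[? ?] /andP[? ?] ? ?; nra.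
split.
  move=> [m hm]; have := hN (maxn m N) (leq_maxr _ _).
  by have := hm (maxn m N) (leq_maxl _ _); lra.
apply/cvgrPdist_lt => e e0; move/cvgrPdist_lt : cv => /(_ (e / 2) ltac:(lra)).
move=> [M _ uM]; exists (maxn M N) => // n /=.
rewrite geq_max => /andP[/uM /= + /hN]; rewrite !sub0r !normrN.
move=> /(le_lt_trans (ler_norm _)); have /andP[? ?] := u01 n.
by rewrite ger0_norm; nra.
Qed.

End Dichotomy.

(** * The approximants and their band as multipliers *)

Section Approximants.
Context {R : realType}.
Local Notation mu := (@lebesgue_measure R).
Local Notation intble k := (mu.-integrable setT (EFin \o k)).
Implicit Types (e x xi theta : R) (n : nat).

(** The factor [n + 10] is [2 + (n + 8)]: two factors of band [bandwidth n] and a cosine of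
    frequency [carrier n] enter the new term. *)
Fixpoint bandwidth n : nat :=
  if n is n.+1 then ((n + 10) * bandwidth n)%N else 1%N.

(* The factor must exceed [3] for the cross terms to vanish and must be unbounded
   for the density to vanish: the bands gained up to frequency [carrier n] have
   total length [O(bandwidth n)]. *)
Definition carrier n : nat := ((n + 8) * bandwidth n)%N.

Fixpoint approx n x : R :=
  if n is n.+1 then
    approx n x + approx n x * (1 - approx n x) * cos (2 * pi * (carrier n)%:R * x)
  else fejer 1 x.

Definition bump n x : R := approx n x * (1 - approx n x).

Local Notation b n := ((bandwidth n)%:R : R).
Local Notation N n := ((carrier n)%:R : R).

Lemma bandwidth_ge1 n : 1 <= b n.
Proof.
by rewrite ler1n; elim: n => //= n IH; rewrite muln_gt0 IH andbT addn_gt0 orbT.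
Qed.

Lemma bandwidthS n : b n.+1 = (n%:R + 10) * b n.
Proof. by rewrite /= natrM natrD. Qed.

Lemma carrierE n : N n = (n%:R + 8) * b n.
Proof. by rewrite natrM natrD. Qed.

Lemma carrier_ge n : 8 * b n <= N n.
Proof. by rewrite carrierE; have := bandwidth_ge1 n; have := ler0n R n; nra. Qed.

Lemma bandwidth_carrier n : b n + b n + N n = b n.+1.
Proof. by rewrite bandwidthS carrierE; ring. Qed.

(** For [a] in [0, 1] and |c| <= 1, the number a + a (1 - a) c lies between a^2 and 1 - (1 -
    a)^2. *)
Lemma approx01 n x : 0 <= approx n x <= 1.
Proof.
elim: n => [|n /andP[]] /=; first by rewrite fejer_ge0 fejer_le1.
have := cos_max (2 * pi * N n * x); rewrite ler_norml => /andP[].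
move: (cos _) (approx n x) => c a c1 c2 a0 a1; apply/andP.
have g0 : 0 <= a * (1 - a) by nra.
split; nra.
Qed.

Lemma bump01 n x : 0 <= bump n x <= 1.
Proof.
by rewrite /bump; have /andP[? ?] := approx01 n x; apply/andP; split; nra.
Qed.

Lemma approxS_dist n x : `|approx n.+1 x - approx n x| <= bump n x.
Proof.
rewrite /= [X in `|X|]addrAC subrr add0r normrM ger0_norm.
  by rewrite ler_piMr ?cos_max//; have /andP[] := bump01 n x.
by have /andP[] := bump01 n x.
Qed.

Lemma multiplier_approx n : multiplier (b n) (approx n).
Proof.
elim: n => [|n IH]; first exact: multiplier_fejer.
have b0 := bandwidth_ge1 n; have N0 := carrier_ge n.
rewrite -bandwidth_carrier; apply: multiplierD.
  by apply: multiplier_le IH; lra.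
apply: multiplierM; last by apply: multiplier_cos.
apply: multiplierM => //; apply: multiplierD; first by apply: multiplier_cst; lra.
under eq_fun do rewrite -mulN1r.
by rewrite -[b n]add0r; apply: multiplierM => //; exact: multiplier_cst.
Qed.
End Approximants.

(** * Integrals of the approximants and decay of the bumps *)

Section Energy.
Context {R : realType}.
Local Notation mu := (@lebesgue_measure R).
Local Notation intble k := (mu.-integrable setT (EFin \o k)).
Implicit Types (e x xi theta : R) (n : nat).
Local Notation b n := ((bandwidth n)%:R : R).
Local Notation N n := ((carrier n)%:R : R).
Local Notation approx := (@approx R).
Local Notation bump := (@bump R).

Lemma measurable_approx n : measurable_fun setT (approx n).
Proof. by have [] := @multiplier_approx R n. Qed.

Lemma multiplier_oneBapprox n : multiplier (b n) (fun x => 1 - approx n x).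
Proof.
have b0 := @bandwidth_ge1 R n; have Ma := @multiplier_approx R n.
apply: multiplierD; first by apply: multiplier_cst; lra.
under eq_fun do rewrite -mulN1r.
by rewrite -[b n]add0r; apply: multiplierM => //; exact: multiplier_cst.
Qed.

Lemma multiplier_bump n : multiplier (b n + b n) (bump n).
Proof.
apply: multiplierM; [exact: multiplier_approx|exact: multiplier_oneBapprox].
Qed.

Lemma measurable_bump n : measurable_fun setT (bump n).
Proof. by have [] := multiplier_bump n. Qed.

Lemma band_approx n : band (b n) (approx n).
Proof.
elim: n => [|n IH]; first exact: band_fejer.
have b0 := @bandwidth_ge1 R n; have N0 := @carrier_ge R n.
(* Factoring [approx n] out of [approx n.+1] leaves a bounded multiplier acting on the integrable
   function of the induction hypothesis. *)
have Mc : multiplier (b n + N n) (fun x => 1 + (1 - approx n x) * cos (2 * pi * N n * x)).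
  apply: multiplierD; first by apply: multiplier_cst; lra.
  by apply: multiplierM; [exact: multiplier_oneBapprox|apply: multiplier_cos].
have [_ _ /(_ _ _ IH)] := Mc.
rewrite addrAC bandwidth_carrier.
congr band; apply/funext => x /=; ring.
Qed.

Lemma band_bump n : band (b n + b n) (bump n).
Proof.
have [_ _ /(_ _ _ (band_approx n))] := multiplier_oneBapprox n.
by congr band; apply/funext => x; rewrite mulrC.
Qed.

Lemma integrable_approx n : intble (approx n).
Proof. by have [] := band_approx n. Qed.

Lemma integrable_bump n : intble (bump n).
Proof. by have [] := band_bump n. Qed.

Lemma Rintegral_band_cos s k nu : band s k -> s < nu ->
  \int[mu]_x (k x * cos (2 * pi * nu * x)) = 0.
Proof.
move=> [_ bk] snu; under eq_Rintegral do rewrite -[2 * pi * nu * _]addr0.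
by rewrite bk// (lt_le_trans snu)// ler_norm.
Qed.

Lemma integrable_cos_linear (a : R) k : intble k ->
  intble (fun x => k x * cos (a * x)).
Proof.
move=> ik; under eq_fun do rewrite -[a * _]addr0; exact: integrable_cos_affine.
Qed.

Lemma Rintegral_approx n : \int[mu]_x approx n x = \int[mu]_x fejer 1 x.
Proof.
elim: n => //= n IH; have b0 := @bandwidth_ge1 R n; have N0 := @carrier_ge R n.
rewrite RintegralD//; last 2 first.
- exact: integrable_approx.
- exact: integrable_cos_linear (integrable_bump n).
by rewrite IH (Rintegral_band_cos (band_bump n)) ?addr0//; lra.
Qed.

Lemma band_bumpM n s k : band s k -> band (b n + b n + s) (fun x => bump n x * k x).
Proof. by move=> bk; have [_ _] := multiplier_bump n; apply. Qed.

Lemma integrable_bump_sqr n : intble (fun x => bump n x ^+ 2).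
Proof.
have [i _] := band_bumpM n (band_bump n).
by move: i; congr (mu.-integrable _ _); apply/funext => x /=; rewrite expr2.
Qed.

Lemma integrable_approx_sqr n : intble (fun x => approx n x ^+ 2).
Proof.
have [_ _ /(_ _ _ (band_approx n)) [i _]] := @multiplier_approx R n.
by move: i; congr (mu.-integrable _ _); apply/funext => x /=; rewrite expr2.
Qed.

Lemma Rintegral_approxS_sqr n : \int[mu]_x (approx n.+1 x ^+ 2) =
  \int[mu]_x (approx n x ^+ 2) + 2^-1 * \int[mu]_x (bump n x ^+ 2).
Proof.
have b0 := @bandwidth_ge1 R n; have N0 := @carrier_ge R n.
have bfg := bandZ 2 (band_bumpM n (band_approx n)).
have bgg := bandZ 2^-1 (band_bumpM n (band_bump n)).
have ifg := bfg.1; have igg := bgg.1.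
have iff2 := integrable_approx_sqr n.
under eq_Rintegral => x _.
  rewrite (_ : _ ^+ 2 = approx n x ^+ 2 +
      (2 * (bump n x * approx n x) * cos (2 * pi * N n * x) +
      (2^-1 * (bump n x * bump n x) +
       2^-1 * (bump n x * bump n x) * cos (2 * pi * (N n + N n) * x)))); last first.
    rewrite (_ : 2 * pi * (N n + N n) * x = 2 * pi * N n * x *+ 2); last first.
      by rewrite mulr2n; ring.
    by rewrite cos_mulr2n /= -/(bump n x) mulr2n; field.
  over.
have ic1 := integrable_cos_linear (2 * pi * N n) ifg.
have ic2 := integrable_cos_linear (2 * pi * (N n + N n)) igg.
rewrite RintegralD//; last exact: integrableD ic1 (integrableD measurableT igg ic2).
rewrite RintegralD//; last exact: integrableD igg ic2.
(* The products have bands [3 b n] and [4 b n], below the frequencies [N n >= 8 b n] and [2 N n] of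
   their cosines. *)
rewrite RintegralD// (Rintegral_band_cos bfg); last by lra.
rewrite (Rintegral_band_cos bgg); last by lra.
rewrite add0r addr0; congr (_ + _).
by rewrite RintegralZl//; exact: (band_bumpM n (band_bump n)).1.
Qed.

Lemma sum_bump_sqr_le n :
  \sum_(j < n) \int[mu]_x (bump j x ^+ 2) <= 2 * \int[mu]_x fejer 1 x.
Proof.
have sE : \sum_(j < n) \int[mu]_x (bump j x ^+ 2) =
    2 * (\int[mu]_x (approx n x ^+ 2) - \int[mu]_x (approx 0 x ^+ 2)).
  elim: n => [|n IH]; first by rewrite big_ord0 subrr mulr0.
  by rewrite big_ord_recr/= IH Rintegral_approxS_sqr; field.
rewrite sE ler_pM2l// -(Rintegral_approx n) lerBlDr.
rewrite (@le_trans _ _ (\int[mu]_x approx n x))//.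
  apply: le_Rintegral => //; [exact: integrable_approx_sqr|exact: integrable_approx|].
  by move=> x _; have /andP[] := @approx01 R n x; nra.
by rewrite lerDl Rintegral_ge0// => x _; exact: sqr_ge0.
Qed.

Lemma bump_cvg0 : {ae mu, forall x, bump ^~ x @ \oo --> 0}.
Proof.
pose g n x := (bump n x ^+ 2)%:E.
have mg n : measurable_fun setT (g n).
  by apply/measurable_EFinP/measurable_funX; exact: measurable_bump.
have g0 n x : (0 <= g n x)%E by rewrite lee_fin sqr_ge0.
have ig : mu.-integrable setT (fun x => \sum_(n <oo) g n x)%E.
  apply/integrableP; split.
    exact: (@ge0_emeasurable_sum _ _ _ _ g xpredT).
  under eq_integral do rewrite gee0_abs ?nneseries_ge0//.
  rewrite integral_nneseries//.
  apply: (@le_lt_trans _ _ (2 * \int[mu]_x fejer 1 x)%:E); last exact: ltry.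
  apply: lime_le; first by apply: is_cvg_nneseries => n _ _; exact: integral_ge0.
  apply: nearW => n; rewrite big_mkord.
  rewrite (eq_bigr (fun j : 'I_n => (\int[mu]_x (bump j x ^+ 2))%:E)); last first.
    by move=> j _; rewrite /Rintegral fineK//; exact: integrable_fin_num (integrable_bump_sqr j).
  by rewrite sumEFin lee_fin; exact: sum_bump_sqr_le.
apply: ae_mono (integrable_ae measurableT ig) => x /(_ Logic.I) fin.
(* Where the sum of squares is finite, the real series converges and its terms tend to zero. *)
have cs : cvgn (series (fun n => bump n x ^+ 2)).
  apply: nondecreasing_is_cvgn.
    by apply/nondecreasing_seqP => n; rewrite seriesSr lerDl sqr_ge0.
  exists (fine (\sum_(n <oo) g n x)%E) => _ [n _ <-].
  rewrite -lee_fin fineK//.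
  rewrite /series/= -sumEFin.
  by apply: (@nneseries_lim_ge R (g ^~ x) xpredT 0 n) => ? _ _; exact: g0.
have /cvgrPdist_lt c0 := cvg_series_cvg_0 cs.
apply/cvgrPdist_lt => e e0; have := c0 (e ^+ 2) (exprn_gt0 _ e0).
apply: filterS => n; rewrite !sub0r !normrN normrX ltr_pXn2r ?nnegrE//; exact: ltW.
Qed.

End Energy.

(** * The limit set: measure and vanishing frequencies *)

Section LimitSet.
Context {R : realType}.
Local Notation mu := (@lebesgue_measure R).
Local Notation intble k := (mu.-integrable setT (EFin \o k)).
Implicit Types (e x xi theta : R) (n : nat).
Local Notation b n := ((bandwidth n)%:R : R).
Local Notation N n := ((carrier n)%:R : R).
Local Notation approx := (@approx R).
Local Notation bump := (@bump R).

Definition late_set m : set R :=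
  \bigcap_(n in [set n | (m <= n)%N]) [set x | 2^-1 <= approx n x].

(** The lower limit of the sets [approx n >= 1/2]. Being defined at every point, it is measurable
    without discarding the null set where convergence fails. *)
Definition limit_set : set R := \bigcup_m late_set m.

Lemma measurable_late_set m : measurable (late_set m).
Proof.
apply: bigcap_measurable => [|n _]; first by exists m => /=.
rewrite -[X in measurable X]setTI (_ : [set x | _] = approx n @^-1` `[2^-1, +oo[%classic).
  by apply: measurable_approx => //; exact: measurable_itv.
by apply/seteqP; split=> x /=; rewrite in_itv/= andbT.
Qed.

Lemma measurable_limit_set : measurable limit_set.
Proof. by apply: bigcup_measurable => m _; exact: measurable_late_set. Qed.

Lemma limit_setE x :
  limit_set x <-> exists m, forall n, (m <= n)%N -> 2^-1 <= approx n x.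
Proof. by split=> [[m _ h]|[m h]]; exists m => // n; exact: h. Qed.

Lemma approx_cvg : {ae mu, forall x, approx ^~ x @ \oo --> (\1_limit_set x : R)}.
Proof.
apply: ae_mono bump_cvg0 => x cx.
have [[/limit_setE Sx cv]|[nS cv]] := @cvg_dichotomy R (approx ^~ x)
    (fun n => @approx01 R n x) (fun n => @approxS_dist R n x) cx.
  by rewrite indicE mem_set.
by rewrite indicE memNset// => /limit_setE.
Qed.

(** Markov's inequality for [approx m] at level 1/2; the integral of [approx m] does not depend on
    [m]. *)
Lemma late_set_measure_le m :
  (mu (late_set m) <= (2 * \int[mu]_x fejer 1 x)%:E)%E.
Proof.
have ia := @integrable_approx R m.
have mS := measurable_late_set m.
rewrite -(setIT (late_set m)) -(integral_indic lebesgue_measure measurableT mS).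
rewrite -(Rintegral_approx m) -RintegralZl// /Rintegral fineK; last first.
  exact: integrable_fin_num (integrableZl measurableT 2 ia).
apply: ge0_le_integral => //.
- exact/measurable_EFinP.
- by apply/measurable_EFinP/measurable_funM => //; exact: measurable_approx.
move=> x _; rewrite lee_fin indicE; have /andP[a0 _] := @approx01 R m x.
case: (boolP (x \in late_set m)) => [/set_mem /(_ m (leqnn m)) /=|_] /=; lra.
Qed.

Lemma limit_set_measure_lty : (mu limit_set < +oo)%E.
Proof.
apply: (@le_lt_trans _ _ (2 * \int[mu]_x fejer 1 x)%:E); last exact: ltry.
have cv : mu \o late_set @ \oo --> mu limit_set.
  apply: nondecreasing_cvg_mu.
  - by move=> m; exact: measurable_late_set.
  - exact: measurable_limit_set.
  - move=> m n mn; apply/subsetPset => x h k /= nk; apply: h => /=.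
    exact: leq_trans nk.
rewrite -(cvg_lim _ cv)//; apply: lime_le; first exact: (cvgP _ cv).
by apply: nearW => m; exact: late_set_measure_le.
Qed.

Lemma integrable_limit_set : intble (\1_limit_set : R -> R).
Proof.
apply/integrableP; split.
  by apply/measurable_EFinP; apply: measurable_indic; exact: measurable_limit_set.
under eq_integral do rewrite /= ger0_norm//.
rewrite integral_indic ?setIT//; first exact: limit_set_measure_lty.
exact: measurable_limit_set.
Qed.

(* Multiplying by the small-band kernel [fejer e] makes the sequence dominated. *)
Lemma Rintegral_limit_set_fejer e xi theta : 0 < e ->
  (forall n, b n + b n + e < `|xi - N n| /\ b n + b n + e < `|xi + N n|) ->
  \int[mu]_x (\1_limit_set x * fejer e x * cos (2 * pi * xi * x + theta)) =
  \int[mu]_x (fejer 1 x * fejer e x * cos (2 * pi * xi * x + theta)).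
Proof.
move=> e0 far; have bfe := band_fejer e0; have ife := bfe.1.
have mfe : measurable_fun setT (fejer e : R -> R) := measurable_sinc_sqr _.
have mc := @measurable_cos_affine R (2 * pi * xi) theta.
(* The increment times [fejer e] has its frequencies within [2 b n + e] of [N n] or [- N n], so it
   is invisible at [xi]. *)
have iE n : \int[mu]_x (approx n x * fejer e x * cos (2 * pi * xi * x + theta)) =
    \int[mu]_x (fejer 1 x * fejer e x * cos (2 * pi * xi * x + theta)).
  elim: n => // n <-.
  have bbf := band_bumpM n bfe; have [f1 f2] := far n.
  under eq_Rintegral => x _.
    rewrite (_ : _ * _ * _ = approx n x * fejer e x * cos (2 * pi * xi * x + theta) +
      cos (2 * pi * N n * x) * (bump n x * fejer e x) * cos (2 * pi * xi * x + theta));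
      last by rewrite /= -/(bump n x); ring.
    over.
  rewrite RintegralD//; last 2 first.
  - apply: integrable_cos_affine.
    have [_ _ /(_ _ _ bfe)] := @multiplier_approx R n; by case.
  - apply: integrable_cos_affine.
    by have [_ _ /(_ _ _ bbf)] := @multiplier_cos R (N n) (ler0n _ _); case.
  by rewrite (band_modulate _ bbf)// addr0.
have [] := @Rintegral_cvg R
  (fun n x => approx n x * fejer e x * cos (2 * pi * xi * x + theta))
  (fun x => \1_limit_set x * fejer e x * cos (2 * pi * xi * x + theta))
  (fejer e).
- move=> n; apply: measurable_funM => //; apply: measurable_funM => //.
  exact: measurable_approx.
- apply: measurable_funM => //; apply: measurable_funM => //.
  by apply: measurable_indic; exact: measurable_limit_set.
- apply: ae_mono approx_cvg => x cx; apply: cvgM; last exact: cvg_cst.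
  by apply: cvgM; [exact: cx|exact: cvg_cst].
- exact: ife.
- move=> n x; rewrite 2!normrM (ger0_norm (fejer_ge0 _ _)).
  have /andP[a0 a1] := @approx01 R n x; rewrite (ger0_norm a0).
  rewrite -[leRHS]mulr1; apply: ler_pM; rewrite ?cos_max//.
    by rewrite mulr_ge0// fejer_ge0.
  by rewrite ler_piMl// fejer_ge0.
by move=> _; under eq_fun do rewrite iE; move=> cv; rewrite -(cvg_lim _ cv)// lim_cst.
Qed.

(** For widths [d <= e] the kernel-weighted integral is zero, because [fejer 1 * fejer d] has band
    [1 + d]. As [d] tends to [0] the weight tends to [1], with the integrable indicator as
    majorant. *)
Lemma Rintegral_limit_set_cos e xi theta : 0 < e -> 1 + e < `|xi| ->
  (forall n, b n + b n + e < `|xi - N n| /\ b n + b n + e < `|xi + N n|) ->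
  \int[mu]_x (\1_limit_set x * cos (2 * pi * xi * x + theta)) = 0.
Proof.
move=> e0 xi1 far; pose d n := e * n.+1%:R^-1.
have d0 n : 0 < d n by rewrite mulr_gt0// invr_gt0.
have de n : d n <= e by rewrite ler_piMr ?(ltW e0)// invf_le1 ?ler1n.
have mc := @measurable_cos_affine R (2 * pi * xi) theta.
have mS : measurable_fun setT (\1_limit_set : R -> R).
  by apply: measurable_indic; exact: measurable_limit_set.
have iE n : \int[mu]_x (\1_limit_set x * fejer (d n) x * cos (2 * pi * xi * x + theta)) = 0.
  rewrite Rintegral_limit_set_fejer//; last first.
    by move=> k; have [? ?] := far k; have := de n; split; lra.
  have [_ _ /(_ _ _ (band_fejer (d0 n))) [_ ->//]] := @multiplier_fejer R 1 ler01.
  by have := de n; lra.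
have [] := @Rintegral_cvg R
  (fun n x => \1_limit_set x * fejer (d n) x * cos (2 * pi * xi * x + theta))
  (fun x => \1_limit_set x * cos (2 * pi * xi * x + theta)) (\1_limit_set).
- move=> n; apply: measurable_funM => //; apply: measurable_funM => //.
  exact: measurable_sinc_sqr.
- exact: measurable_funM.
- apply: aeW => x; apply: cvgM; last exact: cvg_cst.
  rewrite -[X in _ --> X]mulr1; apply: cvgM; first exact: cvg_cst.
  have cd : pi * d n * x @[n --> \oo] --> (0 : R).
    rewrite -(mul0r x) -(mulr0 pi) -(mulr0 e).
    apply: cvgM; last exact: cvg_cst.
    by apply: cvgM; [exact: cvg_cst|apply: cvgM; [exact: cvg_cst|exact: cvg_harmonic]].
  rewrite /fejer -[X in _ --> X](expr1n _ 2).
  under eq_fun do rewrite expr2; rewrite expr2.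
  by apply: cvgM; apply: (cvg_comp _ _ cd); exact: sinc_cvg0.
- exact: integrable_limit_set.
- move=> n x; rewrite 2!normrM (ger0_norm (fejer_ge0 _ _)) indicE.
  rewrite ger0_norm// -mulrA ler_piMr//.
  by rewrite mulr_ile1 ?fejer_ge0 ?fejer_le1 ?cos_max.
by move=> _; under eq_fun do rewrite iE; move=> cv; rewrite -(cvg_lim _ cv)// lim_cst.
Qed.

(** Frequency [0] with [e = 1] is far from every carrier, as [2 b n + 1 < 8 b n]. The integral of
    [fejer 1] over the set therefore equals that of [fejer 1 ^+ 2], which is positive; on a null set
    it would be zero. *)
Lemma limit_set_measure_gt0 : (0 < mu limit_set)%E.
Proof.
rewrite lt0e measure_ge0 andbT; apply/eqP => S0.
have mS := measurable_limit_set.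
have := @Rintegral_limit_set_fejer 1 0 0 ltr01.
have -> : \int[mu]_x (\1_limit_set x * fejer 1 x * cos (2 * pi * 0 * x + 0)) = 0.
  rewrite /Rintegral (@ae_eq_integral _ _ _ mu setT (cst 0%E))//.
  - by rewrite integral0.
  - apply/measurable_EFinP/measurable_funM; last exact: measurable_cos_affine.
    by apply: measurable_funM; [exact: measurable_indic|exact: measurable_sinc_sqr].
  - exists limit_set; split=> // x /= /not_implyP[_ h]; apply: contrapT => nS.
    by apply: h; rewrite indicE memNset// !mul0r.
move=> h; have {h} := h _.
have far n : b n + b n + 1 < `|0 - N n| /\ b n + b n + 1 < `|0 + N n|.
  rewrite sub0r normrN add0r ger0_norm//.
  by have := @carrier_ge R n; have := @bandwidth_ge1 R n; lra.
move=> /(_ far).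
under eq_Rintegral do rewrite mulr0 mul0r addr0 cos0 mulr1.
have i2 : intble (fun x => fejer 1 x * fejer 1 x).
  by have [_ _ /(_ _ _ (band_fejer ltr01)) []] := @multiplier_fejer R 1 ler01.
move=> /esym ff0; have : (\int[mu]_x `|(fejer 1 x * fejer 1 x)%:E| = 0)%E.
  transitivity (\int[mu]_x (fejer 1 x * fejer 1 x)%:E)%E.
    by apply: eq_integral => x _; rewrite gee0_abs// lee_fin mulr_ge0// fejer_ge0.
  by rewrite -[LHS]fineK; [congr EFin; exact: ff0|exact: integrable_fin_num i2].
move/(ae_eq_integral_abs _ measurableT (measurable_int _ i2)) => [A [mA A0 subA]].
(* The kernel has no zero on ]0, 1[, since [sin] is positive on ]0, pi[. *)
have : (mu `]0%R, 1%R[%classic <= mu A)%E.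
  apply: le_measure; rewrite ?inE//.
  move=> x /=; rewrite in_itv/= => /andP[x0 x1].
  apply: (subA x) => h; case: (h Logic.I).
  apply/eqP; rewrite -expr2 /fejer !expf_neq0// /sinc.
  have px : 0 < pi * 1 * x by rewrite mulr1 mulr_gt0// pi_gt0.
  rewrite (gt_eqF px) mulf_neq0 ?invr_eq0 ?gt_eqF//.
  by rewrite sin_gt0_pi// px mulr1 gtr_pMr// pi_gt0.
by rewrite A0 lebesgue_measure_itv/= lte_fin ltr01 oppr0 adde0 lee_fin ler10.
Qed.

End LimitSet.

(** * Covering the spectrum and estimating its density *)

Section Spectrum.
Context {R : realType}.
Local Notation mu := (@lebesgue_measure R).
Implicit Types (e r x xi theta : R) (j k m n : nat).
Local Notation b n := ((bandwidth n)%:R : R).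
Local Notation N n := ((carrier n)%:R : R).
Local Notation S := (@limit_set R).

Fixpoint band_cover k : set R :=
  if k is j.+1 then
    band_cover j `|` (`[N j - (b j + b j), N j + (b j + b j)]%classic `|`
                      `[- N j - (b j + b j), - N j + (b j + b j)]%classic)
  else `[-1, 1]%classic.

Lemma closed_band_cover k : closed (band_cover k).
Proof.
elim: k => [|k IH] /=; first exact: interval_closed.
by apply: closedU => //; apply: closedU; exact: interval_closed.
Qed.

Lemma measurable_band_cover k : measurable (band_cover k).
Proof.
elim: k => [|k IH] /=; first exact: measurable_itv.
by apply: measurableU => //; apply: measurableU; exact: measurable_itv.
Qed.

(** Each stage adds two windows of length [4 b j]. As [bandwidth] grows at least tenfold, the last
    stage dominates: [18 b k + 8 b k.+1 <= 18 b k.+1]. *)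
Lemma band_cover_measure_le k : (mu (band_cover k.+1) <= (18 * b k)%:E)%E.
Proof.
have step j (C : R) : (mu (band_cover j) <= C%:E)%E ->
    (mu (band_cover j.+1) <= (C + 8 * b j)%:E)%E.
  move=> hC; have mc := measurable_band_cover j; have b1 := @bandwidth_ge1 R j.
  have itvE c : mu `[c - (b j + b j), c + (b j + b j)]%classic = (4 * b j)%:E.
    rewrite lebesgue_measure_itv/= lte_fin ifT; last by lra.
    by rewrite -EFinD; congr EFin; ring.
  apply: (le_trans (measureU2 _ _ _)) => //; first exact: measurableU.
  rewrite EFinD; apply: leeD => //.
  apply: (le_trans (measureU2 _ _ _)) => //.
  apply: (@le_trans _ _ ((4 * b j)%:E + (4 * b j)%:E)%E).
    by apply: leeD; rewrite le_eqVlt; apply/orP; left; apply/eqP; exact: itvE.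
  by rewrite -EFinD lee_fin; lra.
elim: k => [|k IH].
  have h0 : (mu (band_cover 0) <= 2%:E)%E.
    rewrite /= lebesgue_measure_itv/= lte_fin ifT; last by lra.
    by rewrite -EFinD lee_fin; lra.
  by apply: le_trans (step 0%N 2 h0) _; rewrite lee_fin /=; lra.
apply: le_trans (step k.+1 _ IH) _; rewrite lee_fin bandwidthS.
by have := @bandwidth_ge1 R k; have := ler0n R k; nra.
Qed.

(** Only finitely many closed windows are avoided, so one margin serves them all. The bound [e <= 1]
    lets the same margin be used for the windows with [j >= k]. *)
Lemma band_cover_far k xi : ~ band_cover k xi ->
  exists2 e, 0 < e <= 1 & 1 + e < `|xi| /\ forall j, (j < k)%N ->
    b j + b j + e < `|xi - N j| /\ b j + b j + e < `|xi + N j|.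
Proof.
elim: k => [|k IH] /=.
  rewrite in_itv/= -ler_norml => /negP; rewrite -ltNge => h.
  exists (Num.min 1 ((`|xi| - 1) / 2)).
    by rewrite ge_min lexx/= lt_min ltr01/= divr_gt0// subr_gt0.
  split=> //; have : Num.min 1 ((`|xi| - 1) / 2) <= (`|xi| - 1) / 2.
    by rewrite ge_min lexx orbT.
  lra.
move=> /not_orP[/IH[e /andP[e0 e1] [h1 h2]] /not_orP[]].
rewrite /= !in_itv/= -!ler_distl opprK => /negP + /negP.
rewrite -!ltNge => d1 d2.
pose d := Num.min (`|xi - N k| - (b k + b k)) (`|xi + N k| - (b k + b k)).
have d0 : 0 < d by rewrite lt_min !subr_gt0 d1.
have dl : d <= `|xi - N k| - (b k + b k) by rewrite ge_min lexx.
have dr : d <= `|xi + N k| - (b k + b k) by rewrite ge_min lexx orbT.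
have m1 : Num.min e (d / 2) <= e by rewrite ge_min lexx.
have m2 : Num.min e (d / 2) <= d / 2 by rewrite ge_min lexx orbT.
(* Halving [d] makes the inequalities strict. *)
exists (Num.min e (d / 2)).
  by rewrite (le_trans m1)// andbT lt_min e0 divr_gt0.
split; first lra.
move=> j; rewrite ltnS leq_eqVlt => /predU1P[->|jk]; first lra.
by have := h2 j jk; lra.
Qed.

(** The phases [0] and [pi / 2] yield the real and the imaginary part. *)
Lemma fourier_limit_set xi :
  (forall theta, \int[mu]_x (\1_S x * cos (2 * pi * xi * x + theta)) = 0) ->
  fourier (cindic S) xi = 0.
Proof.
move=> h; rewrite /fourier /cintegral /cindic /cexpi /=.
congr Complex.
  apply: eq_trans (h 0); apply: eq_Rintegral => x _.
  by rewrite mul0r subr0 addr0 cosN; congr (_ * cos _); ring.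
apply: eq_trans (h (pi / 2)); apply: eq_Rintegral => x _.
by rewrite mul0r addr0 cosDpihalf sinN; congr (_ * - sin _); ring.
Qed.

Lemma bandwidth_mono (c : R) k j : 0 <= c -> (k <= j)%N ->
  (k%:R + c) * b k <= (j%:R + c) * b j.
Proof.
move=> c0 kj; rewrite -(subnK kj) addnC; elim: (j - k)%N => [|i IH].
  by rewrite addn0.
apply: (le_trans IH); rewrite addnS bandwidthS -natr1 mulrA.
have := @bandwidth_ge1 R (k + i); have := ler0n R (k + i).
move: (b (k + i)) ((k + i)%:R : R) => B s s0 B1.
apply: ler_wpM2r; first by lra.
have : 0 <= s * c by exact: mulr_ge0.
nra.
Qed.

Lemma fourier_support_cover k r xi : r <= (k%:R + 5) * b k ->
  `|xi| < r -> fourier (cindic S) xi != 0 -> band_cover k xi.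
Proof.
move=> rk xir; apply: contraPP => /band_cover_far[e /andP[e0 e1] [h1 h2]].
apply/negP; rewrite negbK; apply/eqP; apply: fourier_limit_set => theta.
apply: (Rintegral_limit_set_cos theta e0 h1) => n.
have [nk|kn] := ltnP n k; first exact: h2.
(* Here [N n - 2 b n = (n + 6) b n >= (k + 6) b k], and [b k >= 1 >= e] leaves [(k + 5) b k], which
   exceeds |xi|. *)
have gap : b n + b n + e + `|xi| < N n.
  have := bandwidth_mono (ler0n R 6) kn; have := @bandwidth_ge1 R k.
  rewrite carrierE; nra.
split.
  by rewrite distrC; have := lerB_dist (N n) xi; rewrite ger0_norm//; lra.
by rewrite [xi + _]addrC; have := lerB_normD (N n) xi; rewrite ger0_norm//; lra.
Qed.

(** A point of the closure inside the open interval is approached by points of the interval where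
    the transform is nonzero; these lie in the cover, which is closed. *)
Lemma spectrum_cover k r : r <= (k%:R + 5) * b k ->
  spectrum (cindic S) `&` `](- r), r[ `<=` band_cover k.
Proof.
move=> rk xi [clx]; rewrite /= in_itv/= => xr.
apply: closed_band_cover => A nA.
have nI : nbhs xi `](- r), r[%classic.
  by apply: open_nbhs_nbhs; split; [exact: interval_open|rewrite /= in_itv].
have [y [y0 [Ay]]] := clx _ (filterI nA nI).
rewrite /= in_itv/= -ltr_norml => yr; exists y; split=> //.
exact: fourier_support_cover rk yr y0.
Qed.

Lemma spectrum_measure_le k r : r <= (k%:R + 6) * b k.+1 ->
  (mu (spectrum (cindic S) `&` `](- r)%R, r[) <= (18 * b k)%:E)%E.
Proof.
move=> rk; apply: le_trans (band_cover_measure_le k); apply: le_measure.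
- rewrite inE; apply: measurableI => //; apply: closed_measurable.
  exact: closed_closure.
- by rewrite inE; exact: measurable_band_cover.
- apply: spectrum_cover.
  by rewrite (_ : k.+1%:R + 5 = k%:R + 6 :> R)// -natr1; ring.
Qed.

Lemma sublinear_spectrum_limit_set : sublinear_measure (spectrum (cindic S)).
Proof.
have key e : 0 < e -> exists M, forall r, M < r ->
   0 < r /\ (mu (spectrum (cindic S) `&` `](- r)%R, r[) <= (e * r)%:E)%E.
  move=> e0; have [m hm] : exists m : nat, 18 / e < m%:R.
    by exists (Num.truncn (18 / e)).+1; exact: truncnS_gt.
  exists ((m%:R + 5) * b m) => r Mr.
  have r0 : 0 < r by have := @bandwidth_ge1 R m; have := ler0n R m; nra.
  have ex : exists k, r <= (k%:R + 5) * b k.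
    exists (Num.truncn r).+1; have := truncnS_gt r.
    by have := @bandwidth_ge1 R (Num.truncn r).+1; nra.
  (* The minimal index is positive. With [k.+1] in its place, [(k + 5) b k < r] while the measure is
     at most [18 b k], so the quotient stays below [18 / (k + 5)], hence below [e] because
     [k >= m > 18 / e]. *)
  case: (ex_minnP ex) => k rk kmin.
  have mk : (m < k)%N.
    rewrite ltnNge; apply/negP => km; move: Mr; apply/negP; rewrite -leNgt.
    exact: le_trans rk (bandwidth_mono (ler0n R 5) km).
  split=> //; case: k rk kmin mk => // k rk kmin; rewrite ltnS => mk.
  have kr : (k%:R + 5) * b k < r.
    by rewrite ltNge; apply/negP => /kmin; rewrite ltnn.
  apply: le_trans (@spectrum_measure_le k _ _) _.
    by rewrite (_ : k%:R + 6 = k.+1%:R + 5 :> R)// -natr1; ring.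
  rewrite lee_fin; apply: (@le_trans _ _ (e * ((k%:R + 5) * b k))); last first.
    by rewrite ler_pM2l// ltW.
  rewrite mulrA ler_wpM2r//; move: hm; rewrite ltr_pdivrMr// => hm.
  have : (m%:R : R) <= k%:R by rewrite ler_nat.
  nra.
rewrite /sublinear_measure.
have cvR : (fine (mu (spectrum (cindic S) `&` `](- r)%R, r[)) / r) @[r --> +oo] --> (0 : R).
  apply/cvgrPdist_le => e /key[M hM]; near=> r.
  have /hM[r0 hr] : M < r by near: r; apply: nbhs_pinfty_gt; exact: num_real.
  rewrite sub0r normrN ger0_norm ?divr_ge0 ?fine_ge0 ?(ltW r0)// ler_pdivrMr//.
  by rewrite -lee_fin fineK// ge0_fin_numE// (le_lt_trans hr)// ltry.
(* Any fixed tolerance makes the measure finite for large [r], and the extended quotient is then the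
   real one. *)
have [M hM] := key 1 ltr01.
apply: (@cvg_trans _ ((fine (mu (spectrum (cindic S) `&` `](- r)%R, r[)) / r)%:E
  @[r --> +oo%R])); last by apply: cvg_EFin; [exact: nearW|exact: cvR].
apply: near_eq_cvg; near=> r.
have /hM[r0 hr] : M < r by near: r; apply: nbhs_pinfty_gt; exact: num_real.
by rewrite EFinM fineK 1?muleC// ge0_fin_numE// (le_lt_trans hr)// ltry.
Unshelve. all: by end_near. Qed.

End Spectrum.

(** * Square integrability of indicators, and the conclusion *)

Lemma L2_cindic (R : realType) (S : set R) : measurable S ->
  (lebesgue_measure S < +oo)%E -> L2 (cindic S).
Proof.
move=> mS fS; split.
  by split => /=; [exact: measurable_indic|exact: measurable_cst].
rewrite /finite_norm unlock /=; apply: poweR_lty.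
apply: le_lt_trans fS; rewrite -[X in lebesgue_measure X]setIT.
rewrite -(integral_indic lebesgue_measure measurableT mS) le_eqVlt; apply/orP; left.
apply/eqP; apply: eq_integral => x _; rewrite indicE; case: (x \in S) => /=.
  by rewrite expr0n addr0 expr1n sqrtr1 normr1 powR1.
by rewrite expr0n addr0 sqrtr0 normr0 powR0.
Qed.

Theorem mainTheorem1 (R : realType) :
  (exists (S : set R) (F : R -> R[i]),
      [/\ measurable S /\ (lebesgue_measure S < +oo)%E,
          L2 F,
          ~ {ae (@lebesgue_measure R), forall x, F x = 0},
          supported_on F S &
          sublinear_measure (spectrum F)]) /\
  (exists S : set R,
      [/\ measurable S,
          (0 < lebesgue_measure S < +oo)%E &
          sublinear_measure (spectrum (cindic S))]).
Proof.
have mS := @measurable_limit_set R.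
have lS := @limit_set_measure_lty R.
have gS := @limit_set_measure_gt0 R.
have sS := @sublinear_spectrum_limit_set R.
split; last by exists (@limit_set R); split=> //; rewrite gS lS.
exists (@limit_set R), (cindic (@limit_set R)); split=> //.
- exact: L2_cindic.
- move=> [A [mA A0 subA]].
  have : (lebesgue_measure (@limit_set R) <= lebesgue_measure A)%E.
    apply: le_measure; rewrite ?inE// => x Sx; apply: (subA x) => /=.
    rewrite /cindic indicE mem_set// => -[/eqP].
    by rewrite oner_eq0.
  by rewrite A0 leNgt gS.
- by apply: aeW => x nS; rewrite /cindic indicE memNset.
Qed.
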